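(* Let $R$ be a unitary (associative) ring and $n\ge 1$. For a nonempty subset $C\subseteq M_n(R)$ let $S_n(C,R)=\{a\in M_n(R)\mid ac=ca\ \text{for all } c\in C\}$, and let $S_n(c,R)=S_n(\{c\},R)$. (1) If $G$ is a finite subgroup of $GL_n(R)$ with a $G$-free point, then $S_n(G,R)\subseteq M_n(R)$ is a separable Frobenius extension. Moreover, if $|G|$ is additionally invertible in $R$, then the extension is also split. (2) Suppose that $R$ has no zero-divisors and $c\in M_n(R)$ is a Jordan-similar matrix with all eigenvalues in the center $Z(R)$. Then $S_n(c,R)\subseteq M_n(R)$ is a separable Frobenius extension. Moreover, the extension $S_n(c,R)\subseteq M_n(R)$ is split if and only if $c$ is similar to a matrix of the form $\mathrm{diag}(r_1I_{n_1},r_2I_{n_2},\dots,r_tI_{n_t})$ with $\sum_i n_i=n$, $r_i\in Z(R)$, and $r_i\ne r_j$ for $1\le i\ne j\le t$.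
   Context: For a subgroup $G$ of $GL_n(R)$, an element $i\in\{1,\dots,n\}$ is a $G$-free point if $g_{ii}=0$ for all $g=(g_{pq})\in G\setminus\{I_n\}$. A Jordan block of size $m$ with eigenvalue $r\in R$ is the $m\times m$ matrix with $r$ on the main diagonal, $1$ on the superdiagonal, and $0$ elsewhere. A Jordan-block matrix is a block diagonal matrix whose diagonal blocks are Jordan blocks; its eigenvalues are the eigenvalues of its blocks. A matrix $c\in M_n(R)$ is Jordan-similar if there is $u\in GL_n(R)$ such that $ucu^{-1}$ is a Jordan-block matrix; ''with all eigenvalues in $Z(R)$'' means that the eigenvalues of this Jordan-block matrix lie in $Z(R)$. Similarity of matrices in $M_n(R)$ means conjugacy by an element of $GL_n(R)$. An extension $B\subseteq A$ of rings means that $B$ is a subring of $A$ with the same identity. It is a Frobenius extension if ${}_BA$ is a finitely generated projective left $B$-module and $\mathrm{Hom}_B({}_BA,B)\simeq {}_AA_B$ as $A$-$B$-bimodules. It is separable if the multiplication map $A\otimes_BA\to A$, $x\otimes y\mapsto xy$, is a split surjection of $A$-$A$-bimodules. It is split if the $B$-$B$-bimodule ${}_BB_B$ is a direct summand of ${}_BA_B$. *)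

(* Defs.v *)
From HB Require Import structures.
From mathcomp Require Import freeg.
From mathcomp Require Import all_boot all_order all_algebra finmap.
From mathcomp Require Import ring_quotient.
From mathcomp Require Import boolp classical_sets functions cardinality.

Set Implicit Arguments.
Unset Strict Implicit.
Unset Printing Implicit Defensive.

Import GRing.Theory.
Local Open Scope ring_scope.
Local Open Scope quotient_scope.

Record is_bimod (A B : pzRingType) (M : zmodType)
    (l : A -> M -> M) (r : M -> B -> M) : Prop := IsBimod {
  bimod_l1 : forall x, l 1 x = x;
  bimod_lM : forall a a' x, l (a * a') x = l a (l a' x);
  bimod_lDl : forall a a' x, l (a + a') x = l a x + l a' x;
  bimod_lDr : forall a x y, l a (x + y) = l a x + l a y;
  bimod_r1 : forall x, r x 1 = x;
  bimod_rM : forall x b b', r x (b * b') = r (r x b) b';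
  bimod_rDr : forall x b b', r x (b + b') = r x b + r x b';
  bimod_rDl : forall x y b, r (x + y) b = r x b + r y b;
  bimod_lr : forall a x b, r (l a x) b = l a (r x b) }.

Record bimodType (A B : pzRingType) := BimodType {
  bimod_sort :> zmodType;
  lact : A -> bimod_sort -> bimod_sort;
  ract : bimod_sort -> B -> bimod_sort;
  bimodP : is_bimod lact ract }.

Definition bimod_hom (A B : pzRingType) (M N : bimodType A B) (f : M -> N) :=
  [/\ forall x y, f (x + y) = f x + f y,
      forall a x, f (lact a x) = lact a (f x) &
      forall x b, f (ract x b) = ract (f x) b].

Definition bimod_iso (A B : pzRingType) (M N : bimodType A B) :=
  exists2 f : M -> N, bimod_hom f & bijective f.

Definition is_subbimod (A B : pzRingType) (M : bimodType A B) (N : set M) :=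
  [/\ N 0,
      forall x y, N x -> N y -> N (x - y),
      forall a x, N x -> N (lact a x) &
      forall x b, N x -> N (ract x b)].

(* Internal direct sum: N is a sub-bimodule of M having a complement N'.      *)
Definition direct_summand (A B : pzRingType) (M : bimodType A B) (N : set M) :=
  is_subbimod N /\
  exists N' : set M,
    [/\ is_subbimod N',
        forall x, exists y z, [/\ N y, N' z & x = y + z] &
        forall x, N x -> N' x -> x = 0].

Section RegularBimodule.
Variable A : pzRingType.

Lemma reg_bimod_subproof :
  is_bimod (fun a x : A => a * x) (fun x a : A => x * a).
Proof.
by split=> *; rewrite ?mul1r ?mulr1 ?mulrA ?mulrDl ?mulrDr.
Qed.

Definition reg_bimod : bimodType A A := BimodType reg_bimod_subproof.
End RegularBimodule.

Section RestrictionOfScalars.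
Variables (A A' B B' : pzRingType).
Variables (f : {rmorphism A' -> A}) (g : {rmorphism B' -> B}).
Variable M : bimodType A B.

Lemma res_bimod_subproof :
  is_bimod (fun a (x : M) => lact (f a) x) (fun (x : M) b => ract x (g b)).
Proof.
have P := bimodP M.
split=> *; rewrite ?rmorph1 ?rmorphM ?rmorphD.
- exact: (bimod_l1 P).
- exact: (bimod_lM P).
- exact: (bimod_lDl P).
- exact: (bimod_lDr P).
- exact: (bimod_r1 P).
- exact: (bimod_rM P).
- exact: (bimod_rDr P).
- exact: (bimod_rDl P).
- exact: (bimod_lr P).
Qed.

Definition res_bimod : bimodType A' B' := BimodType res_bimod_subproof.
End RestrictionOfScalars.

Definition left_module (A B : pzRingType) (M : bimodType A B) : Type := M.

Section LeftModule.
Variables (A B : pzRingType) (M : bimodType A B).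

HB.instance Definition _ := GRing.Zmodule.on (left_module M).

Lemma left_module_scaleA (a b : A) (x : left_module M) :
  lact (b := M) a (lact (b := M) b x) = lact (b := M) (a * b) x.
Proof. by rewrite (bimod_lM (bimodP M)). Qed.
Lemma left_module_scale1 (x : left_module M) : lact (b := M) 1 x = x.
Proof. exact: (bimod_l1 (bimodP M)). Qed.
Lemma left_module_scaleDr (a : A) (x y : left_module M) :
  lact (b := M) a (x + y) = lact (b := M) a x + lact (b := M) a y.
Proof. exact: (bimod_lDr (bimodP M)). Qed.
Lemma left_module_scaleDl (x : left_module M) (a b : A) :
  lact (b := M) (a + b) x = lact (b := M) a x + lact (b := M) b x.
Proof. exact: (bimod_lDl (bimodP M)). Qed.

HB.instance Definition _ := GRing.Zmodule_isLmodule.Build A (left_module M)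
  left_module_scaleA left_module_scale1
  left_module_scaleDr left_module_scaleDl.
End LeftModule.

Definition finitely_generated (B : pzRingType) (P : lmodType B) :=
  exists (m : nat) (x : 'I_m -> P), forall y, exists b : 'I_m -> B,
    y = \sum_(i < m) b i *: x i.

Definition projective (B : pzRingType) (P : lmodType B) :=
  forall (N N' : lmodType B) (g : {linear N -> N'}) (f : {linear P -> N'}),
    (forall y, exists x, g x = y) ->
    exists h : {linear P -> N}, forall p, g (h p) = f p.

(* For a B-A-bimodule M and a B-C-bimodule N, Hom_B(M, N) (left B-linear      *)
(* maps) is an A-C-bimodule via (a . f . c)(x) = f(x a) c.                    *)

Section HomBimodule.
Variables (A B C : pzRingType) (M : bimodType B A) (N : bimodType B C).

Definition hom_pred : {pred M -> N} := fun f =>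
  `[< (forall x y, f (x + y) = f x + f y) /\
      (forall b x, f (lact b x) = lact b (f x)) >].

Lemma lact0 (b : B) : lact (b := N) b 0 = 0.
Proof.
by apply: (addrI (lact (b := N) b 0)); rewrite -(bimod_lDr (bimodP N)) !addr0.
Qed.

Lemma ract0 (c : C) : ract (b := N) 0 c = 0.
Proof.
by apply: (addrI (ract (b := N) 0 c)); rewrite -(bimod_rDl (bimodP N)) !addr0.
Qed.

Lemma lactN (b : B) (x : N) : lact b (- x) = - lact b x.
Proof.
by apply: (addrI (lact b x)); rewrite -(bimod_lDr (bimodP N)) !subrr lact0.
Qed.

Lemma hom_pred_zmod_closed : zmod_closed hom_pred.
Proof.
split=> [|f g /asboolP[fD fB] /asboolP[gD gB]].
  by apply/asboolP; split=> *; rewrite ?addr0 ?lact0.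
have subE x : (f - g) x = f x - g x by [].
apply/asboolP; split=> [x y|b x]; rewrite !subE.
  by rewrite fD gD opprD addrACA.
by rewrite fB gB (bimod_lDr (bimodP N)) lactN.
Qed.

HB.instance Definition _ := GRing.isZmodClosed.Build (M -> N) hom_pred
  hom_pred_zmod_closed.

Record hom_left :=
  HomLeft { hom_fun :> M -> N; hom_funP : hom_fun \in hom_pred }.

HB.instance Definition _ := [isSub for hom_fun].
HB.instance Definition _ := [Choice of hom_left by <:].
HB.instance Definition _ := [SubChoice_isSubZmodule of hom_left by <:].

Lemma hom_lact_subproof (a : A) (f : hom_left) :
  (fun x => f (ract x a)) \in hom_pred.
Proof.
have /asboolP[fD fB] := hom_funP f.
apply/asboolP; split=> [x y|b x].
  by rewrite (bimod_rDl (bimodP M)) fD.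
by rewrite (bimod_lr (bimodP M)) fB.
Qed.
Definition hom_lact a f := HomLeft (hom_lact_subproof a f).

Lemma hom_ract_subproof (f : hom_left) (c : C) :
  (fun x => ract (f x) c) \in hom_pred.
Proof.
have /asboolP[fD fB] := hom_funP f.
apply/asboolP; split=> [x y|b x].
  by rewrite fD (bimod_rDl (bimodP N)).
by rewrite fB (bimod_lr (bimodP N)).
Qed.
Definition hom_ract f c := HomLeft (hom_ract_subproof f c).

Lemma hom_bimod_subproof : is_bimod hom_lact hom_ract.
Proof.
have PM := bimodP M; have PN := bimodP N.
split.
- by move=> f; apply/val_inj/funext => x /=; rewrite (bimod_r1 PM).
- by move=> a a' f; apply/val_inj/funext => x /=; rewrite (bimod_rM PM).
- move=> a a' f; apply/val_inj/funext => x /=; rewrite (bimod_rDr PM).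
  by have /asboolP[-> _] := hom_funP f.
- by move=> a f g; apply/val_inj/funext.
- by move=> f; apply/val_inj/funext => x /=; rewrite (bimod_r1 PN).
- by move=> f c c'; apply/val_inj/funext => x /=; rewrite (bimod_rM PN).
- by move=> f c c'; apply/val_inj/funext => x /=; rewrite (bimod_rDr PN).
- by move=> f g c; apply/val_inj/funext => x /=; rewrite (bimod_rDl PN).
- by move=> a f c; apply/val_inj/funext.
Qed.

Definition hom_bimod : bimodType A C := BimodType hom_bimod_subproof.
End HomBimodule.

(* The tensor product over B of an A-B-bimodule M and a B-C-bimodule N is the *)
(* quotient of the free abelian group on M * N by the smallest subgroup       *)
(* containing the biadditivity and B-balance relators.                        *)

Section Tensor.
Variables (A B C : pzRingType) (M : bimodType A B) (N : bimodType B C).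

Let gen (x : M) (y : N) : {freeg (M * N)%type / int} := << (x, y) >>.

Inductive tensor_relator : {freeg (M * N)%type / int} -> Prop :=
| Tensor_relDl x x' y : tensor_relator (gen (x + x') y - gen x y - gen x' y)
| Tensor_relDr x y y' : tensor_relator (gen x (y + y') - gen x y - gen x y')
| Tensor_relM x b y : tensor_relator (gen (ract x b) y - gen x (lact b y)).

Definition tensor_rel : {pred {freeg (M * N)%type / int}} := fun D =>
  `[< forall I : zmodClosed {freeg (M * N)%type / int},
        (forall D', tensor_relator D' -> D' \in I) -> D \in I >].

Lemma tensor_rel_zmod_closed : zmod_closed tensor_rel.
Proof.
split=> [|D D' /asboolP DI /asboolP D'I].
  by apply/asboolP => I _; apply: rpred0.
by apply/asboolP => I relI; apply: rpredB; [apply: DI | apply: D'I].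
Qed.

HB.instance Definition _ :=
  GRing.isZmodClosed.Build {freeg (M * N)%type / int} tensor_rel
  tensor_rel_zmod_closed.

Lemma tensor_relatorW D : tensor_relator D -> D \in tensor_rel.
Proof. by move=> rD; apply/asboolP => I; apply. Qed.

Definition tensor := Quotient.quot tensor_rel.
HB.instance Definition _ := GRing.Zmodule.on tensor.

Definition tens (x : M) (y : N) : tensor :=
  \pi_(Quotient.quot tensor_rel) (gen x y).

Local Notation pi := (\pi_(Quotient.quot tensor_rel)).

Lemma pi_tensorB D D' : pi (D - D') = pi D - pi D'.
Proof. exact: raddfB. Qed.

Lemma pi_tensor_eq D D' :
  D - D' \in tensor_rel -> pi D = pi D'.
Proof. by rewrite Quotient.idealrBE => /eqP. Qed.

Lemma tensDl x x' y : tens (x + x') y = tens x y + tens x' y.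
Proof.
rewrite /tens -raddfD; apply: pi_tensor_eq.
by rewrite opprD addrA; apply/tensor_relatorW/Tensor_relDl.
Qed.

Lemma tensDr x y y' : tens x (y + y') = tens x y + tens x y'.
Proof.
rewrite /tens -raddfD; apply: pi_tensor_eq.
by rewrite opprD addrA; apply/tensor_relatorW/Tensor_relDr.
Qed.

Lemma tens_balanced x b y : tens (ract x b) y = tens x (lact b y).
Proof. exact/pi_tensor_eq/tensor_relatorW/Tensor_relM. Qed.

Lemma tensor_ind (P : tensor -> Prop) :
  P 0 -> (forall t t', P t -> P t' -> P (t - t')) ->
  (forall x y, P (tens x y)) -> forall t, P t.
Proof.
move=> P0 PB Pt; elim/quotW => D.
have PN t : P t -> P (- t) by rewrite -[- t]sub0r; apply: PB.
have PD t t' : P t -> P t' -> P (t + t').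
  by move=> Pt1 Pt2; rewrite -[t']opprK; apply/PB/PN.
have PMn t m : P t -> P (t *+ m).
  by move=> Pt1; elim: m => [//|m IHm]; rewrite mulrSr; apply: PD.
have PMz t k : P t -> P (t *~ k).
  by case: k => m Pt1; [apply: PMn | apply/PN/PMn].
elim/freeg_ind_dom0: D => [|k [x y] D _ _ IHD]; first by rewrite raddf0.
rewrite raddfD; apply: PD => //.
suff -> : << k *g (x, y) >> = << (x, y) >> *~ k :> {freeg (M * N)%type / int}.
  by rewrite raddfMz; apply/PMz/Pt.
apply/eqP/freeg_eqP => z.
by rewrite -scaler_int coeffZ !coeffU mul1r intz.
Qed.

Section Lift.
Variables (V : zmodType) (f : M -> N -> V).

Definition tens_lift (t : tensor) : V :=
  fglift (fun p => f p.1 p.2 : zmodule V) (repr t).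

Hypothesis fDl : forall x x' y, f (x + x') y = f x y + f x' y.
Hypothesis fDr : forall x y y', f x (y + y') = f x y + f x y'.
Hypothesis fM : forall x b y, f (ract x b) y = f x (lact b y).

Let F := fglift (fun p : (M * N)%type => f p.1 p.2 : zmodule V).

Let FB D D' : F (D - D') = F D - F D'.
Proof. exact: lift_is_additive. Qed.

Let F_gen x y : F (gen x y) = f x y.
Proof. by rewrite /F liftU scale1r. Qed.

Let kerF : {pred {freeg (M * N)%type / int}} := fun D => F D == 0.

Let kerF_zmod_closed : zmod_closed kerF.
Proof.
split=> [|D D' /eqP D0 /eqP D'0]; apply/eqP; last by rewrite FB D0 D'0 subr0.
by rewrite -[0](subrr (0 : {freeg (M * N)%type / int})) FB subrr.
Qed.

Let tens_lift_pi D : tens_lift (pi D) = F D.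
Proof.
pose K := GRing.isZmodClosed.Build _ kerF kerF_zmod_closed.
pose I : zmodClosed {freeg (M * N)%type / int} := HB.pack kerF K.
apply/eqP; rewrite -subr_eq0 -FB.
have : repr (pi D) - D \in tensor_rel.
  by rewrite Quotient.idealrBE reprK.
move=> /asboolP/(_ I); apply=> {}D [x x' y|x y y'|x b y]; apply/eqP.
- by rewrite !FB !F_gen fDl -addrA -opprD subrr.
- by rewrite !FB !F_gen fDr -addrA -opprD subrr.
- by rewrite !FB !F_gen fM subrr.
Qed.

Lemma tens_liftE x y : tens_lift (tens x y) = f x y.
Proof. by rewrite tens_lift_pi F_gen. Qed.

Lemma tens_liftB t t' : tens_lift (t - t') = tens_lift t - tens_lift t'.
Proof.
elim/quotW: t => D; elim/quotW: t' => D'.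
by rewrite -pi_tensorB !tens_lift_pi FB.
Qed.

Lemma tens_liftD t t' : tens_lift (t + t') = tens_lift t + tens_lift t'.
Proof.
have lift0 : tens_lift 0 = 0 by have := tens_liftB 0 0; rewrite !subrr.
have liftN : tens_lift (- t') = - tens_lift t'.
  by rewrite -[- t']sub0r tens_liftB lift0 sub0r.
by rewrite -{1}[t']opprK tens_liftB liftN opprK.
Qed.
End Lift.

Definition tens_lact (a : A) : tensor -> tensor :=
  tens_lift (fun x y => tens (lact a x) y).

Definition tens_ract (t : tensor) (c : C) : tensor :=
  tens_lift (fun x y => tens x (ract y c)) t.

Lemma tens_lactE a x y : tens_lact a (tens x y) = tens (lact a x) y.
Proof.
apply: tens_liftE => [x1 x2 z|x1 y1 y2|x1 b z].
- by rewrite (bimod_lDr (bimodP M)) tensDl.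
- by rewrite tensDr.
- by rewrite -(bimod_lr (bimodP M)) tens_balanced.
Qed.

Lemma tens_lactB a t t' : tens_lact a (t - t') = tens_lact a t - tens_lact a t'.
Proof.
apply: tens_liftB => [x1 x2 z|x1 y1 y2|x1 b z].
- by rewrite (bimod_lDr (bimodP M)) tensDl.
- by rewrite tensDr.
- by rewrite -(bimod_lr (bimodP M)) tens_balanced.
Qed.

Lemma tens_ractE x y c : tens_ract (tens x y) c = tens x (ract y c).
Proof.
apply: (tens_liftE (f := fun x y => tens x (ract y c)))
  => [x1 x2 z|x1 y1 y2|x1 b z].
- by rewrite tensDl.
- by rewrite (bimod_rDl (bimodP N)) tensDr.
- by rewrite tens_balanced (bimod_lr (bimodP N)).
Qed.

Lemma tens_ractB t t' c : tens_ract (t - t') c = tens_ract t c - tens_ract t' c.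
Proof.
apply: tens_liftB => [x1 x2 z|x1 y1 y2|x1 b z].
- by rewrite tensDl.
- by rewrite (bimod_rDl (bimodP N)) tensDr.
- by rewrite tens_balanced (bimod_lr (bimodP N)).
Qed.

Lemma tensor_eq (V : zmodType) (f g : tensor -> V) :
  {morph f : t t' / t - t'} -> {morph g : t t' / t - t'} ->
  (forall x y, f (tens x y) = g (tens x y)) -> f =1 g.
Proof.
move=> fB gB fg; apply: tensor_ind => // [|t t' ft ft'].
  by have := fB 0 0; have := gB 0 0; rewrite !subrr => -> ->.
by rewrite fB gB ft ft'.
Qed.

Lemma tens_bimod_subproof : is_bimod tens_lact tens_ract.
Proof.
have PM := bimodP M; have PN := bimodP N.
split.
- apply: tensor_eq => [t t'|//|x y]; first exact: tens_lactB.
  by rewrite tens_lactE (bimod_l1 PM).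
- move=> a a'; apply: tensor_eq => [t t'|t t'|x y]; rewrite ?tens_lactB //.
  by rewrite !tens_lactE (bimod_lM PM).
- move=> a a'; apply: tensor_eq => [t t'|t t'|x y]; rewrite ?tens_lactB //.
    by rewrite opprD addrACA.
  by rewrite !tens_lactE (bimod_lDl PM) tensDl.
- move=> a t t'; apply: tens_liftD => [x1 x2 z|x1 y1 y2|x1 b z].
  + by rewrite (bimod_lDr PM) tensDl.
  + by rewrite tensDr.
  + by rewrite -(bimod_lr PM) tens_balanced.
- apply: tensor_eq => [t t'|//|x y]; first exact: tens_ractB.
  by rewrite tens_ractE (bimod_r1 PN).
- move=> t c c'; move: t.
  apply: tensor_eq => [t t'|t t'|x y]; rewrite ?tens_ractB //.
  by rewrite !tens_ractE (bimod_rM PN).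
- move=> t c c'; move: t.
  apply: tensor_eq => [t t'|t t'|x y]; rewrite ?tens_ractB //.
    by rewrite opprD addrACA.
  by rewrite !tens_ractE (bimod_rDr PN) tensDr.
- move=> t t' c; apply: tens_liftD => [x1 x2 z|x1 y1 y2|x1 b z].
  + by rewrite tensDl.
  + by rewrite (bimod_rDl PN) tensDr.
  + by rewrite tens_balanced (bimod_lr PN).
- move=> a t c; move: t.
  apply: tensor_eq => [t t'|t t'|x y]; rewrite ?(tens_lactB, tens_ractB) //.
  by rewrite !(tens_lactE, tens_ractE).
Qed.

Definition tens_bimod : bimodType A C := BimodType tens_bimod_subproof.

End Tensor.

(* B is the ring of elements of the subring S of A, embedded in A by val.     *)

Section Extension.
Variables (A : pzRingType) (S : {pred A}) (B : subPzRingType S).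

Let idA : {rmorphism A -> A} := idfun.
Let inB : {rmorphism B -> A} := val.

Definition ext_AB : bimodType A B := res_bimod idA inB (reg_bimod A).
Definition ext_BA : bimodType B A := res_bimod inB idA (reg_bimod A).
Definition ext_BB : bimodType B B := res_bimod inB inB (reg_bimod A).

Definition frobenius_ext :=
  [/\ finitely_generated (left_module ext_BA),
      projective (left_module ext_BA) &
      bimod_iso (hom_bimod ext_BA (reg_bimod B)) ext_AB].

Definition tens_mul : tens_bimod ext_AB ext_BA -> reg_bimod A :=
  tens_lift (M := ext_AB) (N := ext_BA) (V := A) (fun x y : A => x * y).

Lemma tens_mulE (x y : A) :
  tens_mul (tens (M := ext_AB) (N := ext_BA) x y) = x * y.
Proof.
apply: (tens_liftE (M := ext_AB) (N := ext_BA) (V := A))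
  => /= [x1 x2 z|x1 y1 y2|x1 b z].
- exact: mulrDl.
- exact: mulrDr.
- by rewrite mulrA.
Qed.

Definition separable_ext :=
  exists2 s : reg_bimod A -> tens_bimod ext_AB ext_BA,
    bimod_hom s & forall a, tens_mul (s a) = a.

Definition split_ext := direct_summand (M := ext_BB) [set a | a \in S].
End Extension.

Arguments frobenius_ext {A S} B.
Arguments separable_ext {A S} B.
Arguments split_ext {A S} B.

Section Centralizer.
Variables (R : pzRingType) (n : nat) (C : set 'M[R]_n).

Definition Sn_pred : {pred 'M[R]_n} := fun a =>
  `[< forall c, C c -> a *m c = c *m a >].

Lemma Sn_subring_closed : subring_closed Sn_pred.
Proof.
split=> [|a b /asboolP aC /asboolP bC|a b /asboolP aC /asboolP bC].
- by apply/asboolP => c _; rewrite mulmx1 mul1mx.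
- by apply/asboolP => c Cc; rewrite mulmxBl mulmxBr aC ?bC.
- by apply/asboolP => c Cc; rewrite -[a * b]/(a *m b) -mulmxA bC // !mulmxA aC.
Qed.

HB.instance Definition _ :=
  GRing.isSubringClosed.Build 'M[R]_n Sn_pred Sn_subring_closed.

Record Sn := InSn { Sn_mx :> 'M[R]_n; SnP : Sn_mx \in Sn_pred }.

HB.instance Definition _ := [isSub for Sn_mx].
HB.instance Definition _ := [Choice of Sn by <:].
HB.instance Definition _ :=
  GRing.SubChoice_isSubPzRing.Build 'M[R]_n Sn_pred Sn Sn_subring_closed.
End Centralizer.

Section MatrixNotions.
Variable R : pzRingType.

Definition ring_unit (r : R) := exists s, r * s = 1 /\ s * r = 1.

Definition central (r : R) := forall x, r * x = x * r.

Definition no_zero_divisors := forall x y : R, x * y = 0 -> x = 0 \/ y = 0.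

Section Square.
Variable n : nat.
Implicit Types (c d u : 'M[R]_n) (G : set 'M[R]_n).

Definition mutually_inverse u v := u *m v = 1%:M /\ v *m u = 1%:M.

Definition subgroup_GL G :=
  [/\ G 1%:M,
      forall g h, G g -> G h -> G (g *m h) &
      forall g, G g -> exists2 h, G h & mutually_inverse g h].

Definition free_point G (i : 'I_n) := forall g, G g -> g <> 1%:M -> g i i = 0.

Definition similar_mx c d :=
  exists u v, mutually_inverse u v /\ u *m c *m v = d.

Definition block_diagonal t (m : 'I_t -> nat) (D : forall i, 'M[R]_(m i)) d :=
  exists e : (\sum_i m i)%N = n, d = castmx (e, e) (\mxdiag_i D i).
End Square.

Definition jordan_block m (r : R) : 'M[R]_m :=
  \matrix_(i, j) if j == i then r else if j == i.+1 :> nat then 1 else 0.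

Definition jordan_similar n (c : 'M[R]_n) (Z : R -> Prop) :=
  exists t (m : 'I_t -> nat) (r : 'I_t -> R) (d : 'M[R]_n),
    [/\ forall i, (0 < m i)%N,
        forall i, Z (r i),
        block_diagonal (fun i => jordan_block (m i) (r i)) d &
        similar_mx c d].

Definition similar_to_central_diag n (c : 'M[R]_n) :=
  exists t (m : 'I_t -> nat) (r : 'I_t -> R) (d : 'M[R]_n),
    [/\ forall i, (0 < m i)%N,
        forall i, central (r i),
        injective r,
        block_diagonal (fun i => (r i)%:M : 'M[R]_(m i)) d &
        similar_mx c d].
End MatrixNotions.

(* Main.v *)
(** Both centralizers [S] in [A] carry a Frobenius system: an [S]-bimodule map
[E : A -> S] and finite families [x, y] with
[sum_j x_j E(y_j a) = a = sum_j E(a x_j) y_j].  Then [A] over [S] is Frobenius,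
and it is separable as soon as some [d] centralizing [S] has
[sum_j x_j d y_j = 1].

For a group [G] with free point [i], take [E a = sum_g g a g^-1],
[x_j = e_(j,i)], [y_j = e_(i,j)], [d = 1]: since
[sum_j e_(j,i) g e_(i,j) = g_(i,i) I], only [g = 1] contributes.  If [|G|] is
invertible then [E / |G|] is a projection onto [S].

For [c = sum_b rho_b f_b + N], with [f_b] the idempotents of the distinct
eigenvalues and [M_b] the size of the largest Jordan block for [rho_b], take
[E a = sum_b sum_(k < M_b) N^k f_b a f_b N^(M_b-1-k)], [x_(b,j) = e_(j,p_b)],
[y_(b,j) = e_(q_b,j)], [d = N^(M_b-1) f_b] for any one [b], where [(p_b, q_b)]
is the upper right corner of a largest block for [rho_b].  A splitting yields
[d] centralizing [S] with [E d = 1], which forces [N = 0]; conversely, if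
[N = 0] then [a |-> sum_b f_b a f_b] is a projection onto [S]. *)

Require Import Defs.
From HB Require Import structures.
From mathcomp Require Import all_boot all_order all_algebra finmap.
From mathcomp Require Import fingroup perm zify.
From mathcomp Require Import boolp classical_sets functions cardinality.

Set Implicit Arguments.
Unset Strict Implicit.
Unset Printing Implicit Defensive.

Import GRing.Theory.

Local Open Scope ring_scope.
Local Open Scope classical_set_scope.

(** * Frobenius systems and the extension properties they yield *)

Record bimod_endo (A : pzRingType) (S : {pred A}) (E : A -> A) : Prop := {
  bimod_endoD : forall a b, E (a + b) = E a + E b;
  bimod_endoL : forall s a, s \in S -> E (s * a) = s * E a;
  bimod_endoR : forall s a, s \in S -> E (a * s) = E a * s;
  bimod_endo_in : forall a, E a \in S }.

(** The families [x] and [y] are dual bases of [A] over [S] for the form [(a, b) |-> E (a * b)]. *)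
Record frobenius_system (A : pzRingType) (S : {pred A}) (J : finType)
    (E : A -> A) (x y : J -> A) : Prop := {
  frobenius_endo : bimod_endo S E;
  frobenius_dualr : forall a, \sum_j x j * E (y j * a) = a;
  frobenius_duall : forall a, \sum_j E (a * x j) * y j = a }.

Section BimodEndo.
Variables (A : pzRingType) (S : {pred A}) (E : A -> A).
Hypothesis ES : bimod_endo S E.

Lemma bimod_endo0 : E 0 = 0.
Proof. by apply: (addrI (E 0)); rewrite -(bimod_endoD ES) !addr0. Qed.

Lemma bimod_endoB a b : E (a - b) = E a - E b.
Proof. by rewrite -[in RHS](subrK b a) [in RHS](bimod_endoD ES) addrK. Qed.

Lemma bimod_endo_sum (I : finType) (F : I -> A) :
  E (\sum_i F i) = \sum_i E (F i).
Proof. exact: (big_morph E (bimod_endoD ES) bimod_endo0). Qed.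
End BimodEndo.

Lemma subPzRing_closed (A : pzRingType) (S : {pred A}) (B : subPzRingType S) :
  subring_closed S.
Proof.
have valS (b : B) : val b \in S by exact: valP.
split=> [|a b aS bS|a b aS bS].
- by rewrite -(rmorph1 (val : B -> A)) valS.
- by rewrite -(SubK B aS) -(SubK B bS) -rmorphB valS.
- by rewrite -(SubK B aS) -(SubK B bS) -rmorphM valS.
Qed.

Section FrobeniusSystem.
Variables (A : pzRingType) (S : {pred A}) (B : subPzRingType S).
Variables (J : finType) (E : A -> A) (x y : J -> A).
Hypothesis EP : frobenius_system S E x y.

Let ES := frobenius_endo EP.

Let EB (a : A) : B := Sub (E a) (bimod_endo_in ES a).

Let val_EB a : val (EB a) = E a. Proof. exact: SubK. Qed.

Let valS (b : B) : val b \in S. Proof. exact: valP. Qed.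

Let EBD a b : EB (a + b) = EB a + EB b.
Proof. by apply: val_inj; rewrite rmorphD /= !val_EB (bimod_endoD ES). Qed.

Let EBL (s : B) a : EB (val s * a) = s * EB a.
Proof.
by apply: val_inj; rewrite rmorphM /= !val_EB (bimod_endoL ES) ?valS.
Qed.

Lemma frobenius_system_fg : finitely_generated (left_module (ext_BA B)).
Proof.
exists #|J|, (fun i => y (enum_val i)) => a.
exists (fun i => EB (a * x (enum_val i))).
rewrite -[LHS](frobenius_duall EP) (reindex (@enum_val J J)) /=; last first.
  exact: onW_bij (@enum_val_bij J).
by apply: eq_bigr => i _; rewrite -val_EB.
Qed.

(** Dual basis argument: the coordinates [a |-> EB (a * x j)] are left linear and the [y j]
    generate, so choosing preimages of the [f (y j)] determines a linear lift of [f]. *)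
Lemma frobenius_system_projective : projective (left_module (ext_BA B)).
Proof.
move=> N N' g f g_surj.
have [z gz] := choice (fun j => g_surj (f (y j))).
pose h (a : left_module (ext_BA B)) := \sum_j EB (a * x j) *: z j.
have hZ : linear h.
  move=> b u v; rewrite scaler_sumr -big_split /=; apply: eq_bigr => j _.
  by rewrite scalerA -scalerDl -EBL -EBD mulrA -mulrDl.
pose hL := GRing.isLinear.Build B (left_module (ext_BA B)) N *:%R h hZ.
pose hh : {linear left_module (ext_BA B) -> N} := HB.pack h hL.
exists hh => p /=.
rewrite raddf_sum -[in RHS](frobenius_duall EP p).
rewrite (raddf_sum f); apply: eq_bigr => j _.
apply: etrans (linearZ_LR g _ _) _; rewrite gz -val_EB.
exact/esym/(linearZ_LR f).
Qed.

Let hom_expand (f : hom_bimod (ext_BA B) (reg_bimod B)) (a : A) :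
  f a = \sum_j EB (a * x j) * f (y j).
Proof.
have /asboolP[fD fB] := hom_funP f.
have f0 : f 0 = 0 by apply: (addrI (f 0)); rewrite -fD !addr0.
rewrite -[in LHS](frobenius_duall EP a) (big_morph f fD f0).
by apply: eq_bigr => j _; rewrite -val_EB fB.
Qed.

(** The isomorphism is [f |-> sum_j x_j f(y_j)], with inverse sending [a] to the form
    [z |-> E (z * a)]. Each of the two dual basis identities gives one of the two cancellations. *)
Lemma frobenius_system_iso :
  bimod_iso (hom_bimod (ext_BA B) (reg_bimod B)) (ext_AB B).
Proof.
pose phi (f : hom_bimod (ext_BA B) (reg_bimod B)) : ext_AB B :=
  \sum_j x j * val (f (y j)) : A.
have psiP (a : A) :
    (fun z : A => EB (z * a)) \in hom_pred (M := ext_BA B) (N := reg_bimod B).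
  apply/asboolP; split=> [u v|b u] /=; first by rewrite mulrDl EBD.
  by rewrite -mulrA EBL.
pose psi (a : ext_AB B) : hom_bimod (ext_BA B) (reg_bimod B) :=
  HomLeft (psiP a).
exists phi; first split.
- move=> f f'; rewrite /phi -big_split /=; apply: eq_bigr => j _.
  by rewrite rmorphD mulrDr.
(* The action of [a] turns [f (y j)] into [f (y j * a)]; expanding this along the [y k] and summing
   over [j] first restores [a * x k]. *)
- move=> a f; rewrite /phi /= mulr_sumr.
  under eq_bigr => j _.
    rewrite hom_expand rmorph_sum mulr_sumr.
    under eq_bigr => k _ do rewrite rmorphM /= val_EB -mulrA mulrA.
    over.
  rewrite exchange_big; apply: eq_bigr => k _.
  by rewrite -mulr_suml mulrA (frobenius_dualr EP).
- move=> f b; rewrite /phi /= mulr_suml; apply: eq_bigr => j _.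
  by rewrite rmorphM mulrA.
exists psi.
- move=> f; apply/val_inj/funext => z /=.
  rewrite hom_expand /phi; apply: val_inj; rewrite val_EB mulr_sumr.
  rewrite (bimod_endo_sum ES) rmorph_sum; apply: eq_bigr => j _.
  by rewrite rmorphM /= val_EB mulrA (bimod_endoR ES) ?valS.
- move=> a; rewrite /phi /psi /= -[RHS](frobenius_dualr EP).
  by apply: eq_bigr => j _; rewrite val_EB.
Qed.

Lemma frobenius_system_frobenius : frobenius_ext B.
Proof.
split; [exact: frobenius_system_fg | exact: frobenius_system_projective |].
exact: frobenius_system_iso.
Qed.

(** The element [sum_j x_j d (x) y_j] of the tensor product is a Casimir element: it commutes with
    all of [A], and multiplication sends it to [1]. The section multiplies it by [a]. *)
Lemma frobenius_system_separable (d : A) :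
  (forall s, s \in S -> s * d = d * s) -> \sum_j x j * d * y j = 1 ->
  separable_ext B.
Proof.
move=> dS d1.
pose tn (u v : A) := tens (M := ext_AB B) (N := ext_BA B) u v.
pose s (a : A) : tens_bimod (ext_AB B) (ext_BA B) :=
  \sum_j tn (a * x j * d) (y j).
have tnDl u u' v : tn (u + u') v = tn u v + tn u' v by exact: tensDl.
have tnDr u v v' : tn u (v + v') = tn u v + tn u v' by exact: tensDr.
have tn0l v : tn 0 v = 0 by apply: (addrI (tn 0 v)); rewrite -tnDl !addr0.
have tn0r u : tn u 0 = 0 by apply: (addrI (tn u 0)); rewrite -tnDr !addr0.
have tnM u v b : tn (u * E b) v = tn u (E b * v).
  by have := tens_balanced (M := ext_AB B) (N := ext_BA B) u (EB b) v;
    rewrite /= val_EB.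
have P := bimodP (tens_bimod (ext_AB B) (ext_BA B)).
(* Expanding [a * x j] in the [x k] gives coefficients in [S]; these pass [d] and then the tensor
   sign, where they reassemble [y k * a]. Right linearity of [s] is read off this form. *)
have sE a : s a = \sum_j tn (x j * d) (y j * a).
  rewrite /s; under eq_bigr => j _.
    rewrite -[a * x j](frobenius_dualr EP) mulr_suml.
    rewrite (big_morph (tn^~ (y j)) (fun u u' => tnDl u u' (y j)) (tn0l _)).
    under eq_bigr => k _.
      rewrite -mulrA dS ?(bimod_endo_in ES) // mulrA tnM.
      over.
    over.
  rewrite exchange_big; apply: eq_bigr => k _ /=.
  rewrite -(big_morph (tn _) (tnDr _) (tn0r _)); congr (tn _ _).
  by rewrite -[RHS](frobenius_duall EP); apply: eq_bigr => j _; rewrite mulrA.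
exists s; first split.
- move=> a b; rewrite /s -big_split /=; apply: eq_bigr => j _.
  by rewrite !mulrDl tnDl.
- move=> a b; rewrite /s.
  rewrite (big_morph (lact a) (bimod_lDr P a) (lact0 _ a)).
  by apply: eq_bigr => j _ /=; rewrite tens_lactE /= -!mulrA.
- move=> a b; rewrite !sE.
  rewrite (big_morph (fun t => ract t b)
    (fun t t' => bimod_rDl P t t' b) (ract0 _ b)).
  by apply: eq_bigr => j _ /=; rewrite tens_ractE /= -!mulrA.
move=> a; rewrite /s.
have mD (t t' : tens_bimod (ext_AB B) (ext_BA B)) :
    tens_mul (t + t') = tens_mul t + tens_mul t'.
  apply: (tens_liftD (M := ext_AB B) (N := ext_BA B) (V := A))
    => /= [x1 x2 z|x1 y1 y2|x1 b z].
  - exact: mulrDl.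
  - exact: mulrDr.
  - by rewrite mulrA.
have m0 : tens_mul (0 : tens_bimod (ext_AB B) (ext_BA B)) = 0.
  by apply: (addrI (tens_mul (0 : tens_bimod (ext_AB B) (ext_BA B))));
    rewrite -mD !addr0.
rewrite (big_morph (@tens_mul A S B) mD m0).
rewrite -[RHS]mulr1 -d1 mulr_sumr; apply: eq_bigr => j _.
by rewrite tens_mulE !mulrA.
Qed.

(* Every [S]-bimodule map [A -> S] has the form [a |-> E (a d)] with [d] in
   the centralizer of [S]; this is applied to the projection onto [S]. *)
Lemma frobenius_system_split : split_ext B ->
  exists2 d, forall s, s \in S -> s * d = d * s & E d = 1.
Proof.
case=> _ [N' [[N0 NB NL NR] SN' SN0]].
have pP a : exists u : A, u \in S /\ N' (a - u).
  by have [u [v [Su Nv ->]]] := SN' a; exists u; rewrite [_ + v]addrC addrK.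
have [p {}pP] := choice pP.
have ND u v : N' u -> N' v -> N' (u + v).
  move=> Nu Nv; rewrite -[v]opprK; apply: (NB _ _) => //.
  by rewrite -[- v]sub0r; apply: NB.
have [S1 SB SM] := subPzRing_closed B.
have SD u v : u \in S -> v \in S -> u + v \in S.
  by move=> uS vS; rewrite -[v]opprK; apply: (SB _ _) => //;
    rewrite -[- v]sub0r -(subrr 1) !SB.
(* Uniqueness of the decomposition makes the chosen projection [p] an [S]-bimodule map. *)
have p_uniq a u : u \in S -> N' (a - u) -> p a = u.
  move=> uS Nu; have [pS Np] := pP a; apply/eqP; rewrite -subr_eq0.
  apply/eqP/SN0; first exact: SB.
  by have := NB _ _ Nu Np; rewrite opprB addrC addrA subrK.
have pD a b : p (a + b) = p a + p b.
  have [[aS Na] [bS Nb]] := (pP a, pP b); apply: p_uniq; first exact: SD.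
  by rewrite opprD addrACA; apply: ND.
have pL s a : s \in S -> p (s * a) = s * p a.
  move=> sS; have [aS Na] := pP a; apply: p_uniq; first exact: SM.
  by rewrite -mulrBr; have := NL (Sub s sS : B) _ Na; rewrite /= SubK.
have pR s a : s \in S -> p (a * s) = p a * s.
  move=> sS; have [aS Na] := pP a; apply: p_uniq; first exact: SM.
  by rewrite -mulrBl; have := NR _ (Sub s sS : B) Na; rewrite /= SubK.
have p1 : p 1 = 1.
  by apply: p_uniq; rewrite ?subrr.
have pS : bimod_endo S p by split=> // a; have [] := pP a.
(* This is the image of [p] under the Frobenius isomorphism [f |-> sum_j x_j f(y_j)]. *)
exists (\sum_j x j * p (y j)) => [s sS|].
  rewrite mulr_sumr mulr_suml.
  under [RHS]eq_bigr => j _.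
    rewrite -mulrA -pR // -(frobenius_duall EP (y j * s)) (bimod_endo_sum pS).
    rewrite mulr_sumr; under eq_bigr => k _.
      rewrite pL ?(bimod_endo_in ES) // mulrA -[y j * s * _]mulrA.
      over.
    over.
  rewrite exchange_big; apply: eq_bigr => k _ /=.
  by rewrite -mulr_suml (frobenius_dualr EP) mulrA.
rewrite (bimod_endo_sum ES) -[RHS]p1 -(frobenius_duall EP 1).
rewrite (bimod_endo_sum pS); apply: eq_bigr => j _.
rewrite pL ?(bimod_endo_in ES) // mul1r (bimod_endoR ES) //.
by have [] := pP (y j).
Qed.
End FrobeniusSystem.

(** The complement is the kernel of [P]. *)
Lemma projection_split (A : pzRingType) (S : {pred A}) (B : subPzRingType S)
    (P : A -> A) :
  bimod_endo S P -> (forall s, s \in S -> P s = s) -> split_ext B.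
Proof.
move=> PS Pid.
have valS (b : B) : val b \in S by exact: valP.
have [S1 SB SM] := subPzRing_closed B.
split; first split=> /=.
- by rewrite -(subrr 1) SB.
- exact: SB.
- by move=> b u uS; apply: SM.
- by move=> u b uS; apply: SM.
exists [set a | P a = 0]; split; first split=> /=.
- exact: bimod_endo0 PS.
- by move=> u v Pu Pv; rewrite (bimod_endoB PS) Pu Pv subrr.
- by move=> b u Pu; rewrite (bimod_endoL PS) // Pu mulr0.
- by move=> u b Pu; rewrite (bimod_endoR PS) // Pu mul0r.
- move=> a; exists (P a), (a - P a); split=> /=.
  + exact: bimod_endo_in PS a.
  + by rewrite (bimod_endoB PS) (Pid (P a)) ?subrr // (bimod_endo_in PS).
  + by rewrite addrC subrK.
- by move=> a aS /= Pa; rewrite -(Pid a aS).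
Qed.

(** * The centralizer of an element with a primary decomposition *)

(** Stated in an arbitrary ring, so that it can be transported along conjugation. Distinctness of
    the eigenvalues takes the form [primary_regular], and [primary_nilp] only bounds the order of
    nilpotency. *)
Record primary_decomposition (A : pzRingType) (c : A) (T : finType)
    (f rho : T -> A) (N : A) (M : T -> nat) : Prop := {
  primary_idem : forall a b, f a * f b = if a == b then f a else 0;
  primary_sum : \sum_b f b = 1;
  primary_central : forall b z, rho b * z = z * rho b;
  primary_regular : forall a b z, a != b -> (rho a - rho b) * z = 0 -> z = 0;
  primary_comm : forall b, N * f b = f b * N;
  primary_nilp : forall b, N ^+ M b * f b = 0;
  primary_def : c = \sum_b rho b * f b + N }.

(* For Jordan matrices [z |-> sum_j x a j * z * y a j] extracts the entry of [z]
   at the upper right corner of a largest block with the [a]-th eigenvalue. *)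
Definition corner_separating (A : pzRingType) (T J : finType) (f : T -> A)
    (N : A) (M : T -> nat) (x y : T -> J -> A) :=
  forall a b k, (k < M b)%N ->
    \sum_j x a j * (N ^+ k * f b) * y a j = ((a == b) && (k == (M a).-1))%:R.

Lemma exprXC (A : pzRingType) (N z : A) k :
  N * z = z * N -> N ^+ k * z = z * N ^+ k.
Proof. by move=> Nz; apply/commr_sym/commrX/commr_sym. Qed.

(** Multiplying by [N] on either side shifts the summation index; the two extreme terms vanish and
    the others match in pairs. *)
Lemma nilpotent_sum_comm (A : pzRingType) (N z : A) m :
  N ^+ m * z = 0 -> z * N ^+ m = 0 ->
  N * (\sum_(k < m) N ^+ k * z * N ^+ (m.-1 - k)) =
  (\sum_(k < m) N ^+ k * z * N ^+ (m.-1 - k)) * N.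
Proof.
case: m => [|m] Nz zN; first by rewrite big_ord0 mulr0 mul0r.
rewrite mulr_sumr mulr_suml big_ord_recr [RHS]big_ord_recl /=.
rewrite !mulrA -exprS Nz mul0r addr0 expr0 mul1r subn0 -mulrA -exprSr zN add0r.
apply: eq_bigr => i _; rewrite /bump /= add1n !mulrA -exprS -[RHS]mulrA -exprSr.
by rewrite subnSK.
Qed.

Section PrimaryDecomposition.
Variables (A : pzRingType) (c : A) (T : finType) (f rho : T -> A) (N : A).
Variable M : T -> nat.
Hypothesis cP : primary_decomposition c f rho N M.

Let fE := primary_idem cP.
Let rhoC := primary_central cP.
Let Nf := primary_comm cP.

Let fexp k b : N ^+ k * f b = f b * N ^+ k.
Proof. exact: exprXC. Qed.

Lemma primary_mulr b : c * f b = (rho b + N) * f b.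
Proof.
rewrite (primary_def cP) !mulrDl mulr_suml; congr (_ + _).
rewrite (bigD1 b) //= -mulrA fE eqxx big1 ?addr0 // => a /negPf ab.
by rewrite -mulrA fE ab mulr0.
Qed.

Lemma primary_mull b : f b * c = (rho b + N) * f b.
Proof.
rewrite (primary_def cP) mulrDr mulrDl Nf mulr_sumr; congr (_ + _).
rewrite (bigD1 b) //= rhoC mulrA fE eqxx -rhoC big1 ?addr0 // => a.
by rewrite eq_sym => /negPf ab; rewrite rhoC mulrA fE ab mul0r.
Qed.

Lemma primary_idem_comm b : c * f b = f b * c.
Proof. by rewrite primary_mulr primary_mull. Qed.

(* For [X = f a s f b], commutation with [c] gives
   [(rho a - rho b) X = X N - N X]; the right-hand side is a nilpotent operator
   applied to [X], whereas [rho a - rho b] is regular. *)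
Lemma primary_offdiag s a b : s * c = c * s -> a != b -> f a * s * f b = 0.
Proof.
move=> sc ab; set X := f a * s * f b.
have cX : c * X = X * c.
  by rewrite /X !mulrA primary_idem_comm -[f a * c * s]mulrA -sc -!mulrA
    primary_idem_comm.
have XN : (rho a - rho b) * X = X * N - N * X.
  have eL : c * X = (rho a + N) * X by rewrite /X !mulrA primary_mulr.
  have eR : X * c = X * (rho b + N).
    rewrite /X -!mulrA primary_mull; congr (_ * (_ * _)).
    by rewrite mulrDl mulrDr rhoC Nf.
  move: cX; rewrite eL eR mulrDl mulrDr -rhoC mulrBl => /(canRL (addrK _)) ->.
  by rewrite -!addrA addrC !addrA subrK.
pose Y i j := N ^+ i * X * N ^+ j.
have step i j : (rho a - rho b) * Y i j = Y i j.+1 - Y i.+1 j.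
  have -> : (rho a - rho b) * Y i j = N ^+ i * ((rho a - rho b) * X) * N ^+ j.
    by rewrite /Y !mulrA mulrBl mulrBr !rhoC.
  rewrite XN /Y.
  by rewrite mulrBr mulrBl exprS exprSr !mulrA.
(* Here [k] bounds how far [i + j] falls short of [M a + M b]. At [k = 0] one of the exponents
   reaches its nilpotency bound, and [step] with regularity lowers [i + j] by one. *)
suff Y0 k i j : (M a + M b <= i + j + k)%N -> Y i j = 0.
  by have := Y0 (M a + M b)%N 0%N 0%N (leqnn _); rewrite /Y mul1r mulr1.
elim: k i j => [|k IHk] i j leMij; last first.
  by apply: (primary_regular cP ab); rewrite step !IHk ?subrr // ?addnS ?addSn
    -addnS.
have [leMi|ltiM] := leqP (M a) i.
  by rewrite /Y /X !mulrA -(subnK leMi) exprD -[_ * f a]mulrA (primary_nilp cP)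
    mulr0 !mul0r.
have leMj : (M b <= j)%N by lia.
by rewrite /Y /X -!mulrA -fexp -(subnK leMj) exprD -!mulrA (primary_nilp cP)
  !mulr0.
Qed.

(** The off-diagonal components of [s] vanish, so [s] commutes with each [f b], hence with the sum
    of the [rho b * f b]; subtracting this from [c] leaves [N]. *)
Lemma primary_centralizer s : s * c = c * s ->
  (forall b, s * f b = f b * s) /\ s * N = N * s.
Proof.
move=> sc.
have sf b : s * f b = f b * s.
  have -> : s * f b = f b * s * f b.
    rewrite -[LHS]mul1r -(primary_sum cP) mulr_suml (bigD1 b) //= mulrA.
    by rewrite big1 ?addr0 // => a ab; rewrite mulrA primary_offdiag.
  rewrite -[RHS]mulr1 -(primary_sum cP) mulr_sumr (bigD1 b) //=.
  by rewrite big1 ?addr0 // => a ab; rewrite primary_offdiag // eq_sym.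
split=> //; move: sc; rewrite (primary_def cP) mulrDr mulrDl mulr_sumr
  mulr_suml.
rewrite (eq_bigr (fun b => rho b * f b * s)) => [/addrI//|b _].
by rewrite mulrA -rhoC -!mulrA sf.
Qed.

Lemma primary_nilp_comm : N * c = c * N.
Proof.
rewrite (primary_def cP) mulrDr mulrDl mulr_sumr mulr_suml; congr (_ + _).
by apply: eq_bigr => b _; rewrite mulrA -rhoC -!mulrA Nf.
Qed.

(** On the component [b] this is the noncommutative derivative of [X ^ M b] at [N] in the direction
    [f b * a * f b]. *)
Definition primary_trace (a : A) :=
  \sum_b \sum_(k < M b) N ^+ k * (f b * a * f b) * N ^+ ((M b).-1 - k).

Variable S : {pred A}.
Hypothesis S_c : forall s, s \in S <-> s * c = c * s.

(** Elements of [S] commute with [N] and the [f b], so they slide out of every summand. The values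
    commute with [c] because [c] acts on the component [b] as [rho b + N], and [nilpotent_sum_comm]
    handles [N]. *)
Lemma primary_trace_bimod : bimod_endo S primary_trace.
Proof.
have SfN s (sS : s \in S) := primary_centralizer (proj1 (S_c s) sS).
split.
- move=> a b; rewrite -big_split; apply: eq_bigr => i _; rewrite -big_split.
  by apply: eq_bigr => k _; rewrite /= mulrDr !mulrDl mulrDr mulrDl.
- move=> s a sS; have [sf sN] := SfN _ sS.
  rewrite mulr_sumr; apply: eq_bigr => b _; rewrite mulr_sumr.
  apply: eq_bigr => k _; rewrite !mulrA -(exprXC _ (esym sN)).
  by rewrite -[_ * f b * s]mulrA -sf !mulrA.
- move=> s a sS; have [sf sN] := SfN _ sS.
  rewrite mulr_suml; apply: eq_bigr => b _; rewrite mulr_suml.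
  apply: eq_bigr => k _; rewrite -[RHS]mulrA (exprXC _ (esym sN)) -!mulrA.
  by rewrite [s * (f b * _)]mulrA sf -!mulrA.
move=> a; apply/S_c; rewrite mulr_suml mulr_sumr; apply: eq_bigr => b _.
set Z := f b * a * f b.
have fZ : f b * Z = Z by rewrite /Z !mulrA fE eqxx.
have Zf : Z * f b = Z by rewrite /Z -!mulrA fE eqxx.
clearbody Z.
set X := \sum_(k < _) _.
have fX : f b * X = X.
  by rewrite mulr_sumr; apply: eq_bigr => k _;
    rewrite !mulrA -fexp -[_ * f b * Z]mulrA fZ.
have Xf : X * f b = X.
  by rewrite mulr_suml; apply: eq_bigr => k _;
    rewrite -mulrA fexp mulrA -[_ * Z * f b]mulrA Zf.
have NX : N * X = X * N.
  apply: nilpotent_sum_comm.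
    by rewrite -fZ mulrA (primary_nilp cP) mul0r.
  by rewrite -Zf -mulrA -fexp (primary_nilp cP) mulr0.
rewrite -/X; transitivity (X * (rho b + N)).
  rewrite -[in LHS]Xf -mulrA primary_mull -[in RHS]Xf -[RHS]mulrA;
    congr (_ * _).
  by rewrite mulrDl mulrDr rhoC Nf.
by rewrite -[in RHS]fX [RHS]mulrA primary_mulr -mulrA fX mulrDl mulrDr rhoC NX.
Qed.

(** With [N = 0], [c] acts on the component [b] as the central [rho b], so compressing to the
    components lands in the centralizer. *)
Lemma primary_split : N = 0 -> forall B : subPzRingType S, split_ext B.
Proof.
move=> N0 B.
have SfN s (sS : s \in S) := primary_centralizer (proj1 (S_c s) sS).
apply: (@projection_split _ _ _ (fun a => \sum_b f b * a * f b)); first split.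
- move=> a b; rewrite -big_split; apply: eq_bigr => i _.
  by rewrite /= mulrDr mulrDl.
- move=> s a sS; have [sf sN] := SfN _ sS.
  by rewrite mulr_sumr; apply: eq_bigr => b _; rewrite !mulrA sf.
- move=> s a sS; have [sf sN] := SfN _ sS.
  by rewrite mulr_suml; apply: eq_bigr => b _; rewrite -!mulrA sf.
- move=> a; apply/S_c; rewrite mulr_suml mulr_sumr; apply: eq_bigr => b _.
  rewrite -mulrA primary_mull !mulrA primary_mulr N0 !addr0.
  by rewrite -[_ * rho b]rhoC !mulrA.
move=> s /SfN[sf _]; rewrite -[RHS]mulr1 -(primary_sum cP) mulr_sumr.
by apply: eq_bigr => b _; rewrite -sf -mulrA fE eqxx.
Qed.

Variables (J : finType) (x y : T -> J -> A).
Hypothesis M_gt0 : forall b, (0 < M b)%N.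
Hypothesis xyP : corner_separating f N M x y.

(** In each dual identity the corner extraction for [i] leaves a single summand: [k = (M i).-1]
    gives [a * f i] in the first, [k = 0] gives [f i * a] in the second. Summing over [i] gives
    [a]. *)
Lemma primary_frobenius_system :
  frobenius_system S primary_trace (fun p : T * J => x p.1 p.2)
    (fun p => y p.1 p.2).
Proof.
split=> [|a|a]; first exact: primary_trace_bimod.
- transitivity (\sum_i \sum_j x i j * primary_trace (y i j * a)).
    by rewrite pair_big.
  rewrite -[RHS]mulr1 -(primary_sum cP) mulr_sumr; apply: eq_bigr => i _.
  under eq_bigr => j _ do rewrite mulr_sumr.
  rewrite exchange_big /= (bigD1 i) //= [X in _ + X]big1 ?addr0.
    under eq_bigr => j _ do rewrite mulr_sumr.
    rewrite exchange_big /=.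
    have lt_M : ((M i).-1 < M i)%N by rewrite prednK.
    rewrite (bigD1 (Ordinal lt_M)) //= [X in _ + X]big1 ?addr0 => [|k kM].
      rewrite subnn; under eq_bigr => j _ do
        rewrite expr0 mulr1 !mulrA -(mulrA (x i j)).
      by rewrite -!mulr_suml xyP // !eqxx mul1r.
    have kM' : (k == (M i).-1 :> nat) = false by apply: negbTE.
    under eq_bigr => j _ do rewrite !mulrA -(mulrA (x i j)).
    by rewrite -!mulr_suml xyP // kM' andbF !mul0r.
  move=> b bi; under eq_bigr => j _ do rewrite mulr_sumr.
  rewrite exchange_big big1 //= => k _.
  under eq_bigr => j _ do rewrite !mulrA -(mulrA (x i j)).
  by rewrite -!mulr_suml xyP // eq_sym (negPf bi) !mul0r.
- transitivity (\sum_i \sum_j primary_trace (a * x i j) * y i j).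
    by rewrite pair_big.
  rewrite -[RHS]mul1r -(primary_sum cP) mulr_suml; apply: eq_bigr => i _.
  under eq_bigr => j _ do rewrite mulr_suml.
  have eM b (k : 'I_(M b)) :
      \sum_j N ^+ k * (f b * (a * x i j) * f b) * N ^+ ((M b).-1 - k) * y i j =
      N ^+ k * f b * a * ((i == b) && ((M b).-1 - k == (M i).-1)%N)%:R.
    rewrite -xyP; last by have := M_gt0 b; lia.
    by rewrite mulr_sumr; apply: eq_bigr => j _; rewrite (fexp (_ - _)) !mulrA.
  rewrite exchange_big /= (bigD1 i) //= [X in _ + X]big1 ?addr0.
    under eq_bigr => j _ do rewrite mulr_suml.
    rewrite exchange_big /=; under eq_bigr => k _ do rewrite eM.
    rewrite (bigD1 (Ordinal (M_gt0 i))) //= [X in _ + X]big1 ?addr0 => [|k k0].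
      by rewrite expr0 mul1r subn0 !eqxx mulr1.
    have -> : ((M i).-1 - k == (M i).-1)%N = false.
      by move: k0 (M_gt0 i) (ltn_ord k); rewrite -val_eqE /=; lia.
    by rewrite andbF mulr0.
  move=> b bi; under eq_bigr => j _ do rewrite mulr_suml.
  rewrite exchange_big big1 //= => k _.
  by rewrite eM eq_sym (negPf bi) mulr0.
Qed.

Lemma primary_frobenius (B : subPzRingType S) : frobenius_ext B.
Proof. exact: frobenius_system_frobenius primary_frobenius_system. Qed.

Lemma primary_separable (B : subPzRingType S) : separable_ext B.
Proof.
(* If [T] is empty then [1] is an empty sum, so [A] is the zero ring and [d = 0] serves. *)
have [b _|T0] := pickP {: T}; last first.
  apply: (frobenius_system_separable B primary_frobenius_system (d := 0)) =>
    [s|].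
    by rewrite mulr0 mul0r.
  rewrite -(primary_sum cP) !big1 // => [b _|p _]; first by have := T0 b.
  by have := T0 p.1.
apply: (frobenius_system_separable B primary_frobenius_system
  (d := N ^+ (M b).-1 * f b)) => [s|].
  move=> /S_c/primary_centralizer[sf sN].
  by rewrite mulrA -(exprXC _ (esym sN)) -!mulrA sf.
transitivity (\sum_i \sum_j x i j * (N ^+ (M b).-1 * f b) * y i j).
  by rewrite pair_big.
under eq_bigr => i _ do rewrite xyP ?prednK //.
rewrite (bigD1 b) //= !eqxx big1 ?addr0 // => i ib.
by rewrite (negPf ib).
Qed.

(* Splitting yields [d] centralizing [S] with [E d = 1], where [E d] is the sum
   of the [M b N^(M b - 1) f b d]; this is nilpotent on the component [b] as
   soon as [1 < M b]. *)
Lemma primary_split_nilp0 (B : subPzRingType S) : split_ext B -> N = 0.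
Proof.
move=> /(frobenius_system_split primary_frobenius_system)[d dS Ed].
have fd b : f b * d = d * f b.
  by apply/dS/S_c; rewrite primary_idem_comm.
have Nd : N * d = d * N by apply/dS/S_c/primary_nilp_comm.
suff NfM b : N * f b = 0.
  rewrite -[N]mulr1 -(primary_sum cP) mulr_sumr big1 // => b _; exact: NfM.
have [M1|M1] := eqVneq (M b) 1%N.
  by have := primary_nilp cP b; rewrite M1 expr1.
(* Multiply [E d = 1] by [N ^+ (M b).-1 * f b]: components other than [b] die by orthogonality, and
   on [b] the exponent [2 (M b - 1)] is at least [M b] because [M b] is not [1]. *)
have Nf0 : N ^+ (M b).-1 * f b = 0.
  rewrite -[LHS]mulr1 -Ed mulr_sumr big1 // => a _.
  rewrite mulr_sumr big1 // => k _.
  have -> : N ^+ k * (f a * d * f a) * N ^+ ((M a).-1 - k) =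
    N ^+ (M a).-1 * f a * d.
    rewrite fd -[d * _ * _]mulrA fE eqxx -fd -!mulrA -(exprXC _ Nd).
    rewrite [f a * _]mulrA -fexp.
    by rewrite !mulrA -exprD subnKC //; have := ltn_ord k; lia.
  have [->|ab] := eqVneq a b; last first.
    by rewrite (fexp _ a) !mulrA -[_ * f b * f a]mulrA fE eq_sym (negPf ab)
      mulr0 !mul0r.
  rewrite !mulrA -[_ * f b * N ^+ _]mulrA -fexp !mulrA -exprD.
  have -> : ((M b).-1 + (M b).-1 = ((M b).-2 + M b))%N by have := M_gt0 b; lia.
  by rewrite exprD -[_ * N ^+ M b * f b]mulrA (primary_nilp cP) mulr0 !mul0r.
(* The corner entry of the vanishing [N ^+ (M b).-1 * f b] is [1], so the ring is zero. *)
have one0 : 1 = 0 :> A.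
  have /esym := @xyP b b (M b).-1 (eq_leq (prednK (M_gt0 b))).
  by rewrite !eqxx big1 // => j _; rewrite Nf0 mulr0 mul0r.
by rewrite -[LHS]mulr1 one0 mulr0.
Qed.
End PrimaryDecomposition.

(** Conjugation [z |-> v * z * u] is a ring automorphism, and it fixes the central [rho b]. *)
Lemma primary_decomposition_conj (A : pzRingType) (c d u v : A) (T : finType)
    (f rho : T -> A) (N : A) (M : T -> nat) :
  u * v = 1 -> v * u = 1 -> u * c * v = d ->
  primary_decomposition d f rho N M ->
  primary_decomposition c (fun b => v * f b * u) rho (v * N * u) M.
Proof.
move=> uv vu ucv dP; pose phi z := v * z * u.
have phiM a b : phi a * phi b = phi (a * b).
  by rewrite /phi -!mulrA (mulrA u) uv mul1r.
have phiX k a : phi a ^+ k = phi (a ^+ k).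
  elim: k => [|k IHk]; first by rewrite /phi !expr0 mulr1 vu.
  by rewrite !exprS IHk phiM.
split=> [a b||b z|a b z|b|b|].
- rewrite (phiM (f a) (f b)) (primary_idem dP); case: ifP => // _.
  by rewrite /phi mulr0 mul0r.
- by rewrite -mulr_suml -mulr_sumr (primary_sum dP) mulr1.
- exact: (primary_central dP).
- exact: (primary_regular dP).
- by rewrite (phiM N (f b)) (phiM (f b) N) (primary_comm dP).
- by rewrite (phiX _ N) (phiM _ (f b)) (primary_nilp dP) /phi mulr0 mul0r.
have -> : c = phi d by rewrite /phi -ucv !mulrA vu mul1r -mulrA vu mulr1.
rewrite {1}(primary_def dP) /phi mulrDr mulrDl mulr_sumr mulr_suml;
  congr (_ + _).
by apply: eq_bigr => b _; rewrite mulrA -(primary_central dP) !mulrA.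
Qed.

Lemma corner_separating_conj (A : pzRingType) (u v : A) (T J : finType)
    (f : T -> A) (N : A) (M : T -> nat) (x y : T -> J -> A) :
  u * v = 1 -> v * u = 1 -> corner_separating f N M x y ->
  corner_separating (fun b => v * f b * u) (v * N * u) M
    (fun b j => v * x b j * u) (fun b j => v * y b j * u).
Proof.
move=> uv vu xyP a b k kM; pose phi z := v * z * u.
have phiM z t : phi z * phi t = phi (z * t).
  by rewrite /phi -!mulrA (mulrA u) uv mul1r.
have phiX z : phi z ^+ k = phi (z ^+ k).
  elim: {kM} k => [|k IHk]; first by rewrite /phi !expr0 mulr1 vu.
  by rewrite !exprS IHk phiM.
rewrite (phiX N) (phiM _ (f b)).
under eq_bigr => j _ do rewrite (phiM (x a j)) (phiM _ (y a j)).
rewrite -mulr_suml -mulr_sumr xyP //; case: (_ && _);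
  last by rewrite mulr0 mul0r.
by rewrite mulr1 vu.
Qed.

(** * Matrices: block coordinates, Jordan form and diagonal form *)

(** The computation behind both pairs of dual bases: the entry is taken at the free point for a
    group, and at the corner of a largest block for a Jordan matrix. *)
Lemma sum_delta_mx_conj (R : pzRingType) n (z : 'M[R]_n) p q :
  \sum_j delta_mx j p * z * delta_mx q j = (z p q)%:M.
Proof.
apply/matrixP => i l; rewrite summxE !mxE (bigD1 i) //= big1 => [|j /negPf ji].
  rewrite addr0 mxE (bigD1 q) //= big1 => [|k /negPf kq]; last first.
    by rewrite !mxE kq mulr0.
  rewrite !mxE (bigD1 p) //= big1 => [|k /negPf kp]; last first.
    by rewrite mxE kp andbF mul0r.
  by rewrite !mxE !eqxx !addr0 mul1r mulr_natr eq_sym.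
rewrite mxE big1 // => k _; rewrite mxE big1 ?mul0r // => k' _.
by rewrite mxE eq_sym ji mul0r.
Qed.

(** [F] takes natural numbers because the positions of [i] and [j] have types depending on their
    blocks. *)
Lemma mxdiagE (R : pzRingType) t (m : 'I_t -> nat) (D : forall b, 'M[R]_(m b))
    (F : 'I_t -> nat -> nat -> R) :
  (forall b i j, D b i j = F b i j) ->
  forall i j, (\mxdiag_b D b) i j =
    if tagnat.sig1 i == tagnat.sig1 j
    then F (tagnat.sig1 i) (tagnat.sig2 i) (tagnat.sig2 j) else 0.
Proof.
move=> DF i j; rewrite mxE; case: eqP => [e|_]; last by rewrite mxE.
move: (tagnat.sig2 i) (tagnat.sig2 j); rewrite -e => k l.
by rewrite conform_mx_id DF.
Qed.

(** Coordinates identifying indices with pairs of a block and a position, free of the dependent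
    types and the cast in [block_diagonal]. *)
Record block_layout n t (m : 'I_t -> nat) (blk : 'I_n -> 'I_t)
    (pos : 'I_n -> nat) : Prop := {
  layout_lt : forall i, (pos i < m (blk i))%N;
  layout_inj : forall i j, blk i = blk j -> pos i = pos j -> i = j;
  layout_ex : forall b p, (p < m b)%N -> exists2 i, blk i = b & pos i = p }.

Lemma block_diagonal_layout (R : pzRingType) n t (m : 'I_t -> nat)
    (D : forall b, 'M[R]_(m b)) (F : 'I_t -> nat -> nat -> R) (d : 'M[R]_n) :
  (forall b i j, D b i j = F b i j) -> block_diagonal D d ->
  exists blk pos, block_layout m blk pos /\
    forall i j : 'I_n,
      d i j = if blk i == blk j then F (blk i) (pos i) (pos j) else 0.
Proof.
move=> DF [e ->]; case: n / e d => _.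
exists tagnat.sig1, (fun i => tagnat.sig2 i : nat); split; last first.
  by move=> i j; rewrite castmx_id (mxdiagE DF).
split=> [i|i j e|b p pb]; first exact: ltn_ord.
  move=> e2; rewrite -(tagnat.sig2K i) -(tagnat.sig2K j).
  by apply/val_inj/eqP; rewrite tagnat.eq_Rank; apply/andP; split; apply/eqP.
exists (tagnat.Rank b (Ordinal pb)); first by rewrite tagnat.Rank1K.
by rewrite tagnat.Rank2K.
Qed.

Definition label_idem (R : pzRingType) n (T : finType) (cls : 'I_n -> T) b :
    'M[R]_n :=
  diag_mx (\row_i (cls i == b)%:R).

Lemma label_idemMl (R : pzRingType) n (T : finType) (cls : 'I_n -> T) b
    (z : 'M[R]_n) i j :
  (label_idem R cls b * z) i j = if cls i == b then z i j else 0.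
Proof.
rewrite -[_ * _]/(_ *m _) mul_diag_mx !mxE.
by case: ifP => _; rewrite ?mul1r ?mul0r.
Qed.

Lemma label_idemMr (R : pzRingType) n (T : finType) (cls : 'I_n -> T) b
    (z : 'M[R]_n) i j :
  (z * label_idem R cls b) i j = if cls j == b then z i j else 0.
Proof.
rewrite -[_ * _]/(_ *m _) mul_mx_diag !mxE.
by case: ifP => _; rewrite ?mulr1 ?mulr0.
Qed.

Lemma scalar_mxMl (R : pzRingType) n (r : R) (z : 'M[R]_n) i j :
  (r%:M * z) i j = r * z i j.
Proof. by rewrite -diag_const_mx -[_ * _]/(_ *m _) mul_diag_mx !mxE. Qed.

Lemma scalar_mxMr (R : pzRingType) n (r : R) (z : 'M[R]_n) i j :
  (z * r%:M) i j = z i j * r.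
Proof. by rewrite -diag_const_mx -[_ * _]/(_ *m _) mul_mx_diag !mxE. Qed.

(** Regularity holds entrywise: distinct eigenvalues have a nonzero difference, which cancels since
    there are no zero-divisors. *)
Lemma labelled_primary_decomposition (R : pzRingType) n (T : finType)
    (cls : 'I_n -> T) (rho : T -> R) (N : 'M[R]_n) (M : T -> nat) :
  no_zero_divisors R -> injective rho -> (forall b, central (rho b)) ->
  (forall i j, cls i != cls j -> N i j = 0) ->
  (forall b, N ^+ M b * label_idem R cls b = 0) ->
  primary_decomposition (diag_mx (\row_i rho (cls i)) + N) (label_idem R cls)
    (fun b => (rho b)%:M) N M.
Proof.
move=> nzd rho_inj rhoC N0 NM; split=> //.
- move=> a b; apply/matrixP => i j; rewrite label_idemMl.
  have [<-|ab] := eqVneq a b; rewrite !mxE.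
    by case: (_ == a); rewrite //= mul0rn.
  by case: eqP => // ->; rewrite (negPf ab) /= mul0rn.
- apply/matrixP => i j; rewrite summxE !mxE (bigD1 (cls i)) //= !mxE eqxx.
  by rewrite big1 ?addr0 // => b bi; rewrite !mxE eq_sym (negPf bi) /= mul0rn.
- by move=> b z; apply/matrixP => i j; rewrite scalar_mxMl scalar_mxMr rhoC.
- move=> a b z ab z0; apply/matrixP => i j; rewrite mxE.
  have : (rho a - rho b) * z i j = 0.
    by rewrite -scalar_mxMl raddfB z0 mxE.
  by case/nzd => // /subr0_eq/rho_inj ab'; rewrite ab' eqxx in ab.
- move=> b; apply/matrixP => i j; rewrite label_idemMl label_idemMr.
  have [<-|ij] := eqVneq (cls i) (cls j); first by [].
  by rewrite N0 // !if_same.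
- congr (_ + _); apply/matrixP => i j; rewrite summxE mxE (bigD1 (cls i)) //=.
  rewrite scalar_mxMl !mxE eqxx mulr_natr big1 ?addr0 // => b bi.
  by rewrite scalar_mxMl !mxE eq_sym (negPf bi) /= mul0rn mulr0.
Qed.

Lemma block_scalar_primary_decomposition (R : pzRingType) n t (m : 'I_t -> nat)
    (r : 'I_t -> R) (d : 'M[R]_n) :
  no_zero_divisors R -> injective r -> (forall b, central (r b)) ->
  block_diagonal (fun b => (r b)%:M : 'M[R]_(m b)) d ->
  exists f rho, @primary_decomposition 'M[R]_n d 'I_t f rho 0 (fun=> 1%N).
Proof.
move=> nzd r_inj rC.
case/(block_diagonal_layout (F := fun b i j => r b *+ (i == j))) => [b i j|].
  by rewrite mxE.
move=> blk [pos [L dE]]; exists (label_idem R blk), (fun b => (r b)%:M).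
have -> : d = diag_mx (\row_i r (blk i)) + 0.
  apply/matrixP => i j; rewrite addr0 dE !mxE.
  have [<-|ij] := eqVneq i j; first by rewrite !eqxx.
  case: ifP => // /eqP bij; case: eqP => // /(layout_inj L bij) ij'.
  by rewrite ij' eqxx in ij.
apply: labelled_primary_decomposition => // [i j _|b]; first by rewrite mxE.
by rewrite expr1 mul0r.
Qed.

Definition shift_mx (R : pzRingType) n t (blk : 'I_n -> 'I_t)
    (pos : 'I_n -> nat) : 'M[R]_n :=
  \matrix_(i, j) ((blk i == blk j) && (pos j == (pos i).+1))%:R.

Lemma shift_mxX (R : pzRingType) n t (m : 'I_t -> nat) (blk : 'I_n -> 'I_t)
    (pos : 'I_n -> nat) k i j :
  block_layout m blk pos ->
  (shift_mx R blk pos ^+ k) i j =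
    ((blk i == blk j) && (pos j == pos i + k)%N)%:R.
Proof.
move=> L; elim: k j => [|k IHk] j.
  rewrite expr0 mxE addn0; case: eqP => [<-|ij]; first by rewrite !eqxx.
  case: eqP => //= b; case: eqP => // /esym p.
  by case: ij; apply: (layout_inj L).
rewrite exprSr mxE; have [e|ij] := boolP (_ && _).
  have /andP[/eqP be /eqP pe] := e.
  (* The only contributing middle index sits at position [pos i + k]; it exists because [pos j] is
     the next position in the same block. *)
  have [|l bl pl] := layout_ex L (b := blk i) (p := (pos i + k)%N).
    by have := layout_lt L j; rewrite -be pe; lia.
  rewrite (bigD1 l) //= IHk mxE bl pl be pe addnS !eqxx mul1r big1 ?addr0 // =>
    l' ll'.
  rewrite IHk; case: andP => [[/eqP b' /eqP p']|_]; last by rewrite mul0r.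
  by case/eqP: ll'; apply: (layout_inj L); rewrite ?bl ?pl.
rewrite big1 // => l _; rewrite IHk mxE -natrM; case: andP =>
  [[/eqP bl /eqP pl]|_] //.
by rewrite bl pl -addnS in ij *; rewrite (negPf ij).
Qed.

(** The final clause serves the splitting criterion: once [N = 0], it exhibits [d] as diagonal with
    central entries. *)
Lemma jordan_primary_decomposition (R : pzRingType) n t (m : 'I_t -> nat)
    (r : 'I_t -> R) (d : 'M[R]_n) :
  no_zero_divisors R -> (forall b, (0 < m b)%N) -> (forall b, central (r b)) ->
  block_diagonal (fun b => jordan_block (m b) (r b)) d ->
  exists (T : finType) (f rho : T -> 'M[R]_n) N M (x y : T -> 'I_n -> 'M[R]_n),
    [/\ primary_decomposition d f rho N M, forall b, (0 < M b)%N,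
        corner_separating f N M x y &
        exists2 lam : 'I_n -> R, forall i, central (lam i) &
          d = diag_mx (\row_i lam i) + N].
Proof.
move=> nzd m_gt0 rC.
pose F b i j := if j == i then r b else if j == i.+1 :> nat then 1 else 0.
case/(block_diagonal_layout (F := F)) => [b i j|]; first by rewrite mxE.
move=> blk [pos [L dE]].
(* Labels are the distinct eigenvalues, so blocks sharing an eigenvalue form one component. *)
pose T : finType := seq_sub (codom r).
have r_cod b : r b \in codom r by exact: codom_f.
pose lab b : T := SeqSub (r_cod b).
(* [top a] is a largest block with eigenvalue [a]; its size bounds the nilpotency order on the whole
   component. *)
have /choice[top topP] (a : T) :
    exists b, lab b = a /\ forall b', lab b' = a -> (m b' <= m b)%N.
  have /codomP[b0 ab0] := valP a.
  have lab0 : lab b0 == a by rewrite -val_eqE /= -ab0.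
  case: (@arg_maxnP _ b0 (fun b => lab b == a) m lab0) => b /eqP lb bmax.
  by exists b; split=> // b' /eqP; apply: bmax.
pose cls i := lab (blk i).
pose N := shift_mx R blk pos.
have last_lt a : ((m (top a)).-1 < m (top a))%N by rewrite prednK.
(* [p a] and [q a] are the first and last indices of that block, so the entry at [(p a, q a)] is its
   upper right corner. *)
have /choice[p pP] a : exists i, blk i = top a /\ pos i = 0%N.
  by have [i ? ?] := layout_ex L (m_gt0 (top a)); exists i.
have /choice[q qP] a : exists i, blk i = top a /\ pos i = (m (top a)).-1.
  by have [i ? ?] := layout_ex L (last_lt a); exists i.
have dEN : d = diag_mx (\row_i val (cls i)) + N.
  apply/matrixP => i j; rewrite dE !mxE /F.
  have [bij|bij] := eqVneq (blk i) (blk j); last first.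
    case: (eqVneq i j) => [ij|_]; first by rewrite ij eqxx in bij.
    by rewrite /= addr0.
  case: (eqVneq i j) => [<-|ij]; first by rewrite eqxx ltn_eqF // addr0.
  case: eqP => [/esym/(layout_inj L bij) ij'|_];
    first by rewrite ij' eqxx in ij.
  by rewrite add0r /=; case: (_ == _).
exists T, (label_idem R cls), (fun a => (val a)%:M), N, (fun a => m (top a)),
  (fun a j => delta_mx j (p a)), (fun a j => delta_mx (q a) j); split=> //.
- rewrite dEN.
  apply: (@labelled_primary_decomposition R n T cls (fun a => val a)) => //.
  + by move=> a; have /codomP[b ->] := valP a.
  + move=> i j cij; rewrite mxE; case: eqP => //= bij.
    by rewrite /cls bij eqxx in cij.
  + move=> a; apply/matrixP => i j; rewrite label_idemMr (shift_mxX _ _ _ _ L)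
      mxE.
    case: eqP => // /(proj2 (topP a)) le_top.
    case: andP => // -[/eqP bij /eqP pj].
    by have := layout_lt L j; rewrite pj; lia.
- move=> a b k kM; have [[bp pp] [bq pq]] := (pP a, qP a).
  rewrite sum_delta_mx_conj label_idemMr (shift_mxX _ _ _ _ L).
  rewrite /cls bq (proj1 (topP a)) bp pp pq eqxx add0n eq_sym [k == _]eq_sym.
  by case: eqP; rewrite ?scalar_mx0 //= ?raddf0 // => _; case: eqP => //= _;
    rewrite ?raddf0.
exists (fun i => val (cls i)) => // i; exact: rC.
Qed.

(** A permutation of the indices makes equal diagonal entries adjacent. *)
Lemma diag_similar (R : pzRingType) n (lam : 'I_n -> R) :
  (forall i, central (lam i)) ->
  similar_to_central_diag (diag_mx (\row_i lam i)).
Proof.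
move=> lamC; pose s := undup (codom lam); pose t := size s.
pose r (k : 'I_t) := nth 0 s k.
have r_inj : injective r.
  by move=> k l /eqP; rewrite /r nth_uniq ?undup_uniq // => /eqP/val_inj.
have /choice[ki kiP] i : exists k, r k = lam i.
  have : lam i \in s by rewrite mem_undup codom_f.
  by case/(nthP 0) => k kt <-; exists (Ordinal kt).
pose A k := [pred i | lam i == r k].
pose m k := #|A k|.
have sum_m : (\sum_k m k)%N = n.
  rewrite -[RHS]card_ord -sum1_card (partition_big ki predT) //=.
  apply: eq_bigr => k _; rewrite /m -sum1_card; apply: eq_bigl => i.
  by rewrite inE /= -kiP inj_eq.
pose d := castmx (sum_m, sum_m) (\mxdiag_k ((r k)%:M : 'M[R]_(m k))).
have dP : block_diagonal (fun k => (r k)%:M : 'M[R]_(m k)) d by exists sum_m.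
have [k i j|blk [pos [L dE]]] :=
  block_diagonal_layout (F := fun b i j => r b *+ (i == j)) _ dP.
  by rewrite mxE.
(* [sg] sends position [pos i] of block [blk i] to the index of that rank among those with diagonal
   entry [r (blk i)]; by [pos_lt] the default is never reached. *)
pose sg i := nth i (enum (A (blk i))) (pos i).
have pos_lt i : (pos i < size (enum (A (blk i))))%N.
  by rewrite -cardE; apply: layout_lt L i.
have lam_sg i : lam (sg i) = r (blk i).
  by have := mem_nth i (pos_lt i); rewrite mem_enum => /eqP.
have sg_inj : injective sg.
  move=> i j e; have bij : blk i = blk j by apply: r_inj; rewrite -!lam_sg e.
  apply: (layout_inj L bij); move/eqP: e.
  rewrite /sg (set_nth_default j) // -bij nth_uniq ?enum_uniq ?bij //;
    last first.
    by rewrite -bij.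
  by move/eqP.
pose u := perm sg_inj.
exists t, m, r, d; split=> //.
- move=> k; have : r k \in s by rewrite mem_nth.
  rewrite mem_undup => /codomP[i ri]; apply/card_gt0P; exists i.
  by rewrite inE /= ri.
- move=> k; have : r k \in s by rewrite mem_nth.
  by rewrite mem_undup => /codomP[i ->].
exists (perm_mx u), (perm_mx u^-1%g); split.
  by split; rewrite -perm_mxM ?mulgV ?mulVg perm_mx1.
rewrite -row_permE -col_permE; apply/matrixP => i j.
rewrite dE !mxE !permE lam_sg (inj_eq sg_inj).
have [<-|ij] := eqVneq i j; first by rewrite !eqxx.
case: ifP => // /eqP bij; case: eqP => // /(layout_inj L bij) ij'.
by rewrite ij' eqxx in ij.
Qed.

Lemma similar_mx_trans (R : pzRingType) n (c d e : 'M[R]_n) :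
  similar_mx c d -> similar_mx d e -> similar_mx c e.
Proof.
move=> [u [v [[uv vu] <-]]] [u' [v' [[uv' vu'] <-]]].
exists (u' *m u), (v *m v'); split; first split.
- by rewrite mulmxA -(mulmxA u') uv mulmx1.
- by rewrite mulmxA -(mulmxA v) vu' mulmx1.
by rewrite !mulmxA.
Qed.

(** * The centralizer of a finite matrix group with a free point *)

Section GroupCentralizer.
Variables (R : pzRingType) (n : nat) (G : {fset 'M[R]_n}).
Hypothesis GP : subgroup_GL [set` G].

Lemma subgroup_GL_inverse : exists inv : G -> 'M[R]_n,
  forall g, [/\ inv g \in G, val g * inv g = 1 & inv g * val g = 1].
Proof.
have /choice[inv invP] (g : G) :
    exists h, [/\ h \in G, val g * h = 1 & h * val g = 1].
  by have [_ _ /(_ (val g) (valP g))[h Gh [gh hg]]] := GP; exists h.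
by exists inv.
Qed.

Variable inv : G -> 'M[R]_n.
Hypothesis invP :
  forall g, [/\ inv g \in G, val g * inv g = 1 & inv g * val g = 1].

Definition group_trace (a : 'M[R]_n) := \sum_(g : G) val g * a * inv g.

Lemma group_traceD a b : group_trace (a + b) = group_trace a + group_trace b.
Proof.
by rewrite -big_split; apply: eq_bigr => g _; rewrite mulrDr mulrDl.
Qed.

(** Left translation by [c] permutes the group; reindexing along it moves [c] across the sum. *)
Lemma group_trace_central a : group_trace a \in Sn_pred [set` G].
Proof.
apply/asboolP => c Gc; change (group_trace a * c = c * group_trace a).
have [_ GM _] := GP.
pose phi (g : G) : G := FSetSub (GM _ _ Gc (valP g)).
have [_ _ cc] := invP (FSetSub Gc).
have phi_inj : injective phi.
  move=> g h /(congr1 val)/= e; apply: val_inj.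
  by rewrite -[val g]mul1r -[val h]mul1r -cc -!mulrA; congr (_ * _).
rewrite mulr_suml (reindex_inj phi_inj) mulr_sumr; apply: eq_bigr => g _.
have invE : inv (phi g) * c = inv g.
  have [[_ gg _] [_ _ pp]] := (invP g, invP (phi g)).
  rewrite -[LHS]mulr1 -gg !mulrA.
  rewrite -[X in X * _](_ : inv (phi g) * val (phi g) = _).
    by rewrite pp mul1r.
  by rewrite -mulrA.
by rewrite -mulrA invE !mulrA.
Qed.

Lemma group_trace_bimod : bimod_endo (Sn_pred [set` G]) group_trace.
Proof.
have SG s (sS : s \in Sn_pred [set` G]) (g : G) : s * val g = val g * s.
  by move/asboolP: sS => /(_ _ (valP g)).
have SI s (sS : s \in Sn_pred [set` G]) (g : G) : s * inv g = inv g * s.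
  by have [Gg _ _] := invP g; move/asboolP: sS => /(_ _ Gg).
split=> [|s a sS|s a sS|]; [exact: group_traceD | | |
  exact: group_trace_central].
- rewrite mulr_sumr; apply: eq_bigr => g _.
  by rewrite !mulrA SG.
- rewrite mulr_suml; apply: eq_bigr => g _.
  by rewrite -!mulrA SI.
Qed.

Variable i : 'I_n.
Hypothesis iP : free_point [set` G] i.

Lemma group_frobenius_system :
  frobenius_system (Sn_pred [set` G]) group_trace (fun j => delta_mx j i)
    (fun j => delta_mx i j).
Proof.
have [G1 _ _] := GP; pose g1 : G := FSetSub G1.
have inv1 : inv g1 = 1.
  by have [_ _] := invP g1; rewrite [val _]/(1 : 'M[R]_n) mulr1.
have ii g : g != g1 -> val g i i = 0.
  by move=> gg1; apply: iP (valP g) _ => e; case/eqP: gg1; apply: val_inj.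
(* The second dual identity involves inverses: the inverse of a nonidentity element is again a
   nonidentity element of the group. *)
have iiV g : g != g1 -> inv g i i = 0.
  have [Gg gg _] := invP g => gg1; apply: iP Gg _ => e; case/eqP: gg1.
  by apply: val_inj; rewrite -[LHS]mulr1 -[X in _ * X]e.
have trl g a : \sum_j delta_mx j i * (val g * (delta_mx i j * a) * inv g) =
    (val g i i)%:M * a * inv g.
  by rewrite -sum_delta_mx_conj !mulr_suml; apply: eq_bigr => j _;
    rewrite !mulrA.
have trr g a : \sum_j val g * (a * delta_mx j i) * inv g * delta_mx i j =
    val g * a * (inv g i i)%:M.
  by rewrite -sum_delta_mx_conj !mulr_sumr; apply: eq_bigr => j _;
    rewrite !mulrA.
split=> [|a|a]; first exact: group_trace_bimod.
- under eq_bigr => j _ do rewrite mulr_sumr.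
  rewrite exchange_big (eq_bigr _ (fun g _ => trl g a)) (bigD1 g1) //=
    [X in _ + X]big1 => [|g /ii gii].
    by rewrite inv1 addr0 mxE eqxx mul1r mulr1.
  by rewrite gii raddf0 !mul0r.
- under eq_bigr => j _ do rewrite mulr_suml.
  rewrite exchange_big (eq_bigr _ (fun g _ => trr g a)) (bigD1 g1) //=
    [X in _ + X]big1 => [|g /iiV gii].
    by rewrite inv1 addr0 mxE eqxx mul1r mulr1.
  by rewrite gii raddf0 mulr0.
Qed.

Lemma group_split : ring_unit (#|` G|%:R : R) -> split_ext (Sn [set` G]).
Proof.
move=> [s [ns sn]].
(* The inverse of the central element [|G|] is central, so the scalar matrix [s%:M] lies in the
   centralizer and commutes with every matrix. *)
have sC z : s * z = z * s.
  have nz : #|` G|%:R * z = z * #|` G|%:R by rewrite mulr_natl mulr_natr.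
  by rewrite -[LHS]mulr1 -ns mulrA -(mulrA s) -nz mulrA sn mul1r.
have sMC (z : 'M[R]_n) : s%:M * z = z * s%:M.
  by apply/matrixP => k l; rewrite scalar_mxMl scalar_mxMr.
have ES := group_trace_bimod.
have [_ _ SM] := subPzRing_closed (Sn [set` G]).
apply: (@projection_split _ _ _ (fun a => s%:M * group_trace a)); first split.
- by move=> a b; rewrite (bimod_endoD ES) mulrDr.
- by move=> t a tS; rewrite (bimod_endoL ES) // !mulrA sMC.
- by move=> t a tS; rewrite (bimod_endoR ES) // mulrA.
- move=> a; apply: SM; last exact: group_trace_central.
  by apply/asboolP => c _; apply: sMC.
move=> t /asboolP tS; rewrite /group_trace.
rewrite (eq_bigr (fun=> t)) => [|g _]; last first.
  rewrite -[_ * t](tS _ (valP g)) -[LHS]mulrA.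
  by have [_ -> _] := invP g; rewrite mulr1.
rewrite sumr_const -cardfE -mulr_natl mulrA.
rewrite (_ : s%:M * #|` G|%:R = 1) ?mul1r //.
by rewrite -[_%:R]/(_%:R : 'M_n) mulr_natr -raddfMn /= -mulr_natr sn.
Qed.
End GroupCentralizer.

Theorem theorem1p2 (R : pzRingType) (n : nat) (n_gt0 : (0 < n)%N) :
  (forall G : {fset 'M[R]_n},
     subgroup_GL [set` G] -> (exists i : 'I_n, free_point [set` G] i) ->
     [/\ separable_ext (Sn [set` G]),
         frobenius_ext (Sn [set` G]) &
         ring_unit ((#|` G|)%:R : R) -> split_ext (Sn [set` G])]) /\
  (no_zero_divisors R ->
   forall c : 'M[R]_n, jordan_similar c (@central R) ->
     [/\ separable_ext (Sn [set c]),
         frobenius_ext (Sn [set c]) &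
         split_ext (Sn [set c]) <-> similar_to_central_diag c]).
Proof.
split=> [G GP [i iP]|nzd c].
  have [inv invP] := subgroup_GL_inverse GP.
  have sysP := group_frobenius_system GP invP iP.
  split; [|exact: frobenius_system_frobenius sysP|exact: (group_split GP invP)].
  apply: (frobenius_system_separable (Sn [set` G]) sysP (d := 1)) => [s _|].
    by rewrite mulr1 mul1r.
  by rewrite sum_delta_mx_conj mxE eqxx.
have S_c s : s \in Sn_pred [set c] <-> s * c = c * s.
  split=> [/asboolP sP|sc]; first exact: sP.
  by apply/asboolP => _ ->.
move=> [t [m [r [d [m_gt0 rC dP cd]]]]].
have [T [f [rho [N [M [x [y [dN M_gt0 xyP [lam lamC dE]]]]]]]]] :=
  jordan_primary_decomposition nzd m_gt0 rC dP.
have [u [v [[uv vu] ucv]]] := cd.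
have cN := primary_decomposition_conj uv vu ucv dN.
have xyP' := corner_separating_conj uv vu xyP.
split.
- exact: (primary_separable cN S_c M_gt0 xyP' _).
- exact: (primary_frobenius cN S_c M_gt0 xyP' _).
split=> [/(primary_split_nilp0 cN S_c M_gt0 xyP') vNu|].
  have N0 : N = 0.
    have uv1 : u * v = 1 by [].
    transitivity (u * (v * N * u) * v); last by rewrite vNu mulr0 mul0r.
    by rewrite !mulrA uv1 mul1r -mulrA uv1 mulr1.
  (* With [N = 0] the Jordan matrix [d] is diagonal with entries [lam], and it remains to group
     equal entries. *)
  have [t' [m' [r' [e [m'_gt0 r'C r'_inj eP de]]]]] := diag_similar lamC.
  exists t', m', r', e; split=> //; apply: similar_mx_trans cd _.
  by rewrite dE N0 addr0.
(* For the converse, the given diagonal form supplies another primary decomposition of [c], whose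
   nilpotent part is zero. *)
move=> [t' [m' [r' [e [_ r'C r'_inj eP [u' [v' [[uv' vu'] ucv']]]]]]]].
have [f' [rho' eN]] := block_scalar_primary_decomposition nzd r'_inj r'C eP.
apply: (primary_split (primary_decomposition_conj uv' vu' ucv' eN) S_c).
by rewrite mulr0 mul0r.
Qed.
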